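(* Let $k$ be a field and let $H$ be a finite-dimensional filtered Hopf algebra over $k$, with associated graded Hopf algebra $\mathrm{gr}\, H$. Then $\nu_n(H) = \nu_n(\mathrm{gr}\, H)$ for all integers $n \ge 1$.
   Context: For a finite-dimensional Hopf algebra $H$ over $k$ with antipode $S_H$ and $n \ge 1$, $\nu_n(H) = \mathrm{Tr}(S_H \circ P_H^{(n-1)}: H \to H) \in k$, where $P_H^{(m)}$ is the $m$-th convolution power of $\mathrm{id}_H$ ($P_H^{(0)}(h) = \varepsilon(h)1$, $P_H^{(m)}(h) = h_{(1)}\cdots h_{(m)}$ for $m \ge 1$). A filtration on a vector space $V$ is a sequence of subspaces $V_0 \subset V_1 \subset \cdots$ indexed by $\mathbb{Z}_{\ge 0}$ with $V = \bigcup_n V_n$. A filtered Hopf algebra is a Hopf algebra object in the symmetric monoidal category of filtered vector spaces, i.e. a Hopf algebra $H$ with a filtration $\{H_n\}_{n\ge 0}$ such that $1 \in H_0$, $H_i H_j \subset H_{i+j}$, $\Delta(H_n) \subset \sum_{i=0}^n H_i \otimes H_{n-i}$ and $S(H_n) \subset H_n$ (and the counit is filtered, $k$ being placed in degree $0$: a map of Hopf algebra objects structure in filtered vector spaces). Its associated graded Hopf algebra is the image of $H$ under the symmetric monoidal functor $\mathrm{gr}$ from filtered to graded vector spaces, $\mathrm{gr}\,H = \bigoplus_{n \ge 0} H_n/H_{n-1}$ with $H_{-1}=0$, with the induced structure maps. *)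

(* Defs.v *)
From HB Require Import structures.
From mathcomp Require Import all_boot all_algebra all_field.

Set Implicit Arguments.
Unset Strict Implicit.
Unset Printing Implicit Defensive.

Import GRing.Theory.
Import passmx.

Local Open Scope ring_scope.

Reserved Notation "u \ox v" (at level 40, left associativity).

(* The tensor product of two finite-dimensional spaces, in coordinates with   *)
(* respect to their standard bases; tlift_tens and tensor_ind below give its  *)
(* universal property.                                                        *)
Definition tensor (K : fieldType) (U V : vectType K) : Type :=
  'M[K]_(\dim {:U}, \dim {:V}).
HB.instance Definition _ (K : fieldType) (U V : vectType K) :=
  Vector.copy (tensor U V) 'M[K]_(\dim {:U}, \dim {:V}).

Section Tensor.
Variable K : fieldType.
Implicit Types U V W : vectType K.

Definition tens U V (u : U) (v : V) : tensor U V :=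
  (rVof (vbasis fullv) u)^T *m rVof (vbasis fullv) v.

(* If f is bilinear, tlift f is the linear map on U (x) V induced by f: for   *)
(* t = \sum t_(1) \ox t_(2), tlift f t = \sum f t_(1) t_(2).                  *)
Definition tlift U V W (f : U -> V -> W) (t : tensor U V) : W :=
  \sum_i \sum_j t i j *: f (vbasis fullv)`_i (vbasis fullv)`_j.

Definition bilin U V W (f : U -> V -> W) :=
  (forall v, linear (f^~ v)) /\ (forall u, linear (f u)).

Definition tmap U V U' V' (f : U -> U') (g : V -> V') :
    tensor U V -> tensor U' V' :=
  tlift (fun u v => tens (f u) (g v)).

Definition tassoc U V W : tensor (tensor U V) W -> tensor U (tensor V W) :=
  tlift (fun t w => tlift (fun u v => tens u (tens v w)) t).

Definition tensv U V (A : {vspace U}) (B : {vspace V}) :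
    {vspace tensor U V} :=
  <<[seq tens a b | a <- vbasis A, b <- vbasis B]>>%VS.

End Tensor.
Notation "u \ox v" := (tens u v) : ring_scope.

Section TensorTheory.
Variable K : fieldType.
Implicit Types U V W : vectType K.

Lemma tlift_is_linear U V W (f : U -> V -> W) : linear (tlift f).
Proof.
move=> a s t; rewrite /tlift scaler_sumr -big_split; apply: eq_bigr => i _.
rewrite scaler_sumr -big_split; apply: eq_bigr => j _ /=.
by rewrite !mxE scalerDl scalerA.
Qed.
HB.instance Definition _ U V W (f : U -> V -> W) :=
  GRing.isLinear.Build K (tensor U V) W _ (tlift f) (tlift_is_linear f).

HB.instance Definition _ U V U' V' (f : U -> U') (g : V -> V') :=
  GRing.Linear.copy (tmap f g) (tlift (fun u v => f u \ox g v)).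
HB.instance Definition _ U V W :=
  GRing.Linear.copy (@tassoc K U V W)
    (tlift (fun t w => tlift (fun u v => u \ox (v \ox w)) t)).

Lemma tens_bilin U V : bilin (@tens K U V).
Proof.
split=> [v|u] a x y; rewrite /tens.
  by rewrite linearP /= linearP /= mulmxDl -scalemxAl.
by rewrite linearP /= mulmxDr -scalemxAr.
Qed.

Lemma bilin0l U V W (f : U -> V -> W) v : bilin f -> f 0 v = 0.
Proof.
by case=> fl _; have := fl v (-1) 0 0; rewrite scaler0 addr0 scaleN1r addNr.
Qed.
Lemma bilin0r U V W (f : U -> V -> W) u : bilin f -> f u 0 = 0.
Proof.
by case=> _ fr; have := fr u (-1) 0 0; rewrite scaler0 addr0 scaleN1r addNr.
Qed.
Lemma bilinDl U V W (f : U -> V -> W) u1 u2 v :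
  bilin f -> f (u1 + u2) v = f u1 v + f u2 v.
Proof. by case=> fl _; have := fl v 1 u1 u2; rewrite !scale1r. Qed.
Lemma bilinDr U V W (f : U -> V -> W) u v1 v2 :
  bilin f -> f u (v1 + v2) = f u v1 + f u v2.
Proof. by case=> _ fr; have := fr u 1 v1 v2; rewrite !scale1r. Qed.
Lemma bilinZl U V W (f : U -> V -> W) a u v :
  bilin f -> f (a *: u) v = a *: f u v.
Proof.
by move=> fB; have := fB.1 v a u 0; rewrite addr0 (bilin0l _ fB) addr0.
Qed.
Lemma bilinZr U V W (f : U -> V -> W) a u v :
  bilin f -> f u (a *: v) = a *: f u v.
Proof.
by move=> fB; have := fB.2 u a v 0; rewrite addr0 (bilin0r _ fB) addr0.
Qed.
Lemma bilin_suml U V W (f : U -> V -> W) I r (P : pred I) F v :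
  bilin f -> f (\sum_(i <- r | P i) F i) v = \sum_(i <- r | P i) f (F i) v.
Proof.
move=> fB; elim/big_rec2: _ => [|i y1 y2 _ <-]; first exact: bilin0l.
exact: bilinDl.
Qed.
Lemma bilin_sumr U V W (f : U -> V -> W) I r (P : pred I) F u :
  bilin f -> f u (\sum_(i <- r | P i) F i) = \sum_(i <- r | P i) f u (F i).
Proof.
move=> fB; elim/big_rec2: _ => [|i y1 y2 _ <-]; first exact: bilin0r.
exact: bilinDr.
Qed.

Lemma tensDl U V (u1 u2 : U) (v : V) : (u1 + u2) \ox v = u1 \ox v + u2 \ox v.
Proof. exact/bilinDl/tens_bilin. Qed.
Lemma tensDr U V (u : U) (v1 v2 : V) : u \ox (v1 + v2) = u \ox v1 + u \ox v2.
Proof. exact/bilinDr/tens_bilin. Qed.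
Lemma tensZl U V a (u : U) (v : V) : (a *: u) \ox v = a *: (u \ox v).
Proof. exact/bilinZl/tens_bilin. Qed.
Lemma tensZr U V a (u : U) (v : V) : u \ox (a *: v) = a *: (u \ox v).
Proof. exact/bilinZr/tens_bilin. Qed.
Lemma tens0l U V (v : V) : (0 : U) \ox v = 0.
Proof. exact/bilin0l/tens_bilin. Qed.
Lemma tens0r U V (u : U) : u \ox (0 : V) = 0.
Proof. exact/bilin0r/tens_bilin. Qed.

Lemma tlift_tens U V W (f : U -> V -> W) u v :
  bilin f -> tlift f (u \ox v) = f u v.
Proof.
move=> fB; rewrite {2}(coord_vbasis (memvf u)) {2}(coord_vbasis (memvf v)).
rewrite bilin_suml //; apply: eq_bigr => i _.
rewrite bilin_sumr //; apply: eq_bigr => j _.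
rewrite bilinZl // bilinZr // scalerA; congr (_ *: _).
by rewrite /tens !mxE big_ord1 !mxE.
Qed.

Lemma tensorE U V (t : tensor U V) :
  t = \sum_i \sum_j t i j *: ((vbasis fullv)`_i \ox (vbasis fullv)`_j).
Proof.
apply/matrixP=> i0 j0; rewrite summxE (bigD1 i0) //= summxE (bigD1 j0) //=.
rewrite !big1 ?addr0.
- rewrite !mxE big_ord1 !mxE !coord_free ?(basis_free (vbasisP _)) //.
  by rewrite !eqxx !mulr1.
- move=> i ni; rewrite summxE big1 // => j _.
  rewrite !mxE big_ord1 !mxE !coord_free ?(basis_free (vbasisP _)) //.
  by rewrite (negPf ni) mul0r mulr0.
move=> j nj; rewrite !mxE big_ord1 !mxE !coord_free ?(basis_free (vbasisP _)) //.
by rewrite (negPf nj) !mulr0.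
Qed.

Lemma tensor_ind U V (P : tensor U V -> Prop) :
  P 0 -> (forall s t, P s -> P t -> P (s + t)) ->
  (forall u v, P (u \ox v)) -> forall t, P t.
Proof.
move=> P0 PD Pt t; rewrite (tensorE t).
elim/big_rec: _ => // i x _; apply: (PD).
elim/big_rec: _ => // j y _; apply: (PD).
rewrite -bilinZl; last exact: tens_bilin.
exact: Pt.
Qed.

Lemma mem_tensv U V (A : {vspace U}) (B : {vspace V}) a b :
  a \in A -> b \in B -> a \ox b \in tensv A B.
Proof.
move=> aA bB; rewrite (coord_vbasis aA) (coord_vbasis bB).
have tB := @tens_bilin U V.
rewrite bilin_suml // memv_suml // => i _; rewrite bilin_sumr // memv_suml //.
move=> j _; rewrite bilinZl // bilinZr // !memvZ // memv_span //.
by apply/allpairsP; exists ((vbasis A)`_i, (vbasis B)`_j); rewrite !mem_nth ?size_tuple.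
Qed.

Lemma tensv_ind U V (A : {vspace U}) (B : {vspace V})
    (P : tensor U V -> Prop) :
  P 0 -> (forall s t, P s -> P t -> P (s + t)) ->
  (forall a b, a \in A -> b \in B -> P (a \ox b)) ->
  forall t, t \in tensv A B -> P t.
Proof.
move=> P0 PD Pt t.
set L := [seq a \ox b | a <- vbasis A, b <- vbasis B].
rewrite /tensv -/L -[L]/(val (in_tuple L)) => /coord_span ->.
elim/big_rec: _ => // i x _; apply: (PD).
have /allpairsP[[a b] /= [aA bB ->]] : L`_i \in L by rewrite mem_nth.
rewrite -bilinZl; last exact: tens_bilin.
by apply: Pt; rewrite ?memvZ // vbasis_mem.
Qed.

Lemma linear_ext_tens U V W (f g : {linear tensor U V -> W}) :
  (forall u v, f (u \ox v) = g (u \ox v)) -> f =1 g.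
Proof.
move=> fg; apply: tensor_ind => [|s t fs ft|//]; first by rewrite !linear0.
by rewrite !linearD fs ft.
Qed.

Lemma bilin_tens U V U' V' (f : {linear U -> U'}) (g : {linear V -> V'}) :
  bilin (fun u v => f u \ox g v).
Proof.
split=> [v|u] a x y; rewrite linearP.
  by rewrite tensDl tensZl.
by rewrite tensDr tensZr.
Qed.

Lemma tmap_tens U V U' V' (f : {linear U -> U'}) (g : {linear V -> V'}) u v :
  tmap f g (u \ox v) = f u \ox g v.
Proof. exact/tlift_tens/bilin_tens. Qed.

Lemma tassoc_tens U V W (u : U) (v : V) (w : W) :
  tassoc (u \ox v \ox w) = u \ox (v \ox w).
Proof.
have Bw w0 : bilin (fun (u : U) (v : V) => u \ox (v \ox w0)).
  by split=> [v1|u1] a x y; rewrite ?(tensDl, tensZl, tensDr, tensZr).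
rewrite /tassoc tlift_tens ?tlift_tens //; split=> [w1 a x y|t a x y].
  by rewrite linearP.
elim/tensor_ind: t => [|s t IHs IHt|u1 v1]; first by rewrite !linear0 ?scaler0 addr0.
  by rewrite !linearD /= IHs IHt ?scalerDr addrACA.
by rewrite !tlift_tens // !(tensDr, tensZr).
Qed.

End TensorTheory.

Definition quotv (K : fieldType) (V : vectType K) (U : {vspace V}) : Type :=
  {ideal_quot (pred_of_vspace U : zmodClosed V)}.

Section Quotient.
Variables (K : fieldType) (V : vectType K) (U : {vspace V}).

HB.instance Definition _ := GRing.Zmodule.copy (quotv U)
  {ideal_quot (pred_of_vspace U : zmodClosed V)}.

Definition piv (v : V) : quotv U := \pi_{ideal_quot (pred_of_vspace U : zmodClosed V)}%qT v.
Definition reprv (q : quotv U) : V :=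
  repr (q : {ideal_quot (pred_of_vspace U : zmodClosed V)}).

Lemma reprvK : cancel reprv piv.
Proof. exact: reprK. Qed.

Lemma piv_is_additive : {morph piv : x y / x + y}.
Proof. by move=> x y; rewrite /piv raddfD. Qed.
Lemma eq_piv x y : (piv x == piv y) = (x - y \in U).
Proof. by rewrite /piv -Quotient.idealrBE. Qed.

Definition scaleq (a : K) (q : quotv U) : quotv U := piv (a *: reprv q).
Lemma pivZ a x : scaleq a (piv x) = piv (a *: x).
Proof.
by apply/eqP; rewrite eq_piv -scalerBr memvZ // -eq_piv reprvK.
Qed.
Lemma scaleqA a b q : scaleq a (scaleq b q) = scaleq (a * b) q.
Proof. by rewrite -(reprvK q) !pivZ scalerA. Qed.
Lemma scale1q : left_id 1 scaleq.
Proof. by move=> q; rewrite -(reprvK q) pivZ scale1r. Qed.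
Lemma scaleqDr : right_distributive scaleq +%R.
Proof.
move=> a p q; rewrite -(reprvK p) -(reprvK q) -piv_is_additive !pivZ.
by rewrite -piv_is_additive scalerDr.
Qed.
Lemma scaleqDl q : {morph scaleq^~ q : a b / a + b}.
Proof.
by move=> a b; rewrite -(reprvK q) !pivZ -piv_is_additive scalerDl.
Qed.
HB.instance Definition _ := GRing.Zmodule_isLmodule.Build K (quotv U)
  scaleqA scale1q scaleqDr scaleqDl.

Lemma piv_is_linear : linear piv.
Proof. by move=> a x y; rewrite piv_is_additive -pivZ. Qed.
HB.instance Definition _ := GRing.isLinear.Build K V (quotv U) _ piv piv_is_linear.

Lemma piv_eq0 x : (piv x == 0) = (x \in U).
Proof. by rewrite -(linear0 piv) eq_piv subr0. Qed.

Lemma quotv_vect_iso : Vector.axiom (\dim (U^C)%VS) (quotv U).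
Proof.
pose p := daddv_pi (U^C)%VS U.
have UI : (U^C :&: U = 0)%VS by rewrite capvC capv_compl.
have pU x : x \in U -> p x = 0.
  move=> xU; have := daddv_pi_add UI (w := x).
  rewrite addvC addv_complf memvf => /(_ isT).
  by rewrite (daddv_pi_id _ xU) 1?capvC // => /(canRL (addrK _)); rewrite subrr.
have pE x : x - p x \in U.
  have := daddv_pi_add UI (w := x).
  rewrite addvC addv_complf memvf => /(_ isT) {1}<-.
  by rewrite addrAC subrr add0r memv_pi.
have pC x : p x \in (U^C)%VS by exact: memv_pi.
exists (fun q => \row_i coord (vbasis (U^C)%VS) i (p (reprv q))).
  move=> a q r; apply/rowP=> i; rewrite !mxE -linearP -linearP /=; congr (coord _ _ _).
  apply/eqP; rewrite -subr_eq0 -linearB; apply/eqP/pU.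
  by rewrite -piv_eq0 linearB linearP /= !reprvK subrr.
exists (fun w : 'rV_(\dim (U^C)%VS) => piv (\sum_i w 0 i *: (vbasis (U^C)%VS)`_i)).
  move=> q; rewrite -[RHS]reprvK; apply/eqP; rewrite eq_piv -opprB memvN.
  under eq_bigr do rewrite mxE.
  by rewrite -coord_vbasis.
move=> w; apply/rowP=> i; rewrite mxE.
set s := \sum_i _; have sC : s \in (U^C)%VS.
  by apply: memv_suml => j _; rewrite memvZ // vbasis_mem // mem_nth ?size_tuple.
have -> : p (reprv (piv s)) = s.
  rewrite -[RHS](daddv_pi_id UI) //; apply/eqP; rewrite -subr_eq0 -linearB.
  by apply/eqP/pU; rewrite -eq_piv reprvK.
by rewrite coord_sum_free ?(basis_free (vbasisP _)).
Qed.
HB.instance Definition _ := Lmodule_hasFinDim.Build K (quotv U) quotv_vect_iso.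

End Quotient.

Definition dsum (K : fieldType) (n : nat) (V : 'I_n -> vectType K) : Type :=
  {dffun forall i : 'I_n, V i}.

Section DirectSum.
Variables (K : fieldType) (n : nat) (V : 'I_n -> vectType K).

HB.instance Definition _ := Choice.copy (dsum V) {dffun forall i : 'I_n, V i}.

Definition mkdsum (f : forall i, V i) : dsum V := [ffun i => f i].
Definition dproj i (x : dsum V) : V i := x i.

Lemma mkdsumE f i : dproj i (mkdsum f) = f i.
Proof. exact: ffunE. Qed.
Lemma dsumP x y : (forall i, dproj i x = dproj i y) <-> x = y.
Proof. by split=> [xy|-> //]; apply/ffunP=> i; apply: xy. Qed.

Definition dsum_add x y := mkdsum (fun i => dproj i x + dproj i y).
Definition dsum_opp x := mkdsum (fun i => - dproj i x).
Definition dsum_scale (a : K) x := mkdsum (fun i => a *: dproj i x).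

Lemma dsum_addA : associative dsum_add.
Proof. by move=> x y z; apply/dsumP=> i; rewrite !mkdsumE addrA. Qed.
Lemma dsum_addC : commutative dsum_add.
Proof. by move=> x y; apply/dsumP=> i; rewrite !mkdsumE addrC. Qed.
Lemma dsum_add0 : left_id (mkdsum (fun=> 0)) dsum_add.
Proof. by move=> x; apply/dsumP=> i; rewrite !mkdsumE add0r. Qed.
Lemma dsum_addN : left_inverse (mkdsum (fun=> 0)) dsum_opp dsum_add.
Proof. by move=> x; apply/dsumP=> i; rewrite !mkdsumE addNr. Qed.
HB.instance Definition _ := GRing.isZmodule.Build (dsum V)
  dsum_addA dsum_addC dsum_add0 dsum_addN.

Lemma dsum_scaleA a b x : dsum_scale a (dsum_scale b x) = dsum_scale (a * b) x.
Proof. by apply/dsumP=> i; rewrite !mkdsumE scalerA. Qed.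
Lemma dsum_scale1 : left_id 1 dsum_scale.
Proof. by move=> x; apply/dsumP=> i; rewrite !mkdsumE scale1r. Qed.
Lemma dsum_scaleDr : right_distributive dsum_scale +%R.
Proof. by move=> a x y; apply/dsumP=> i; rewrite !mkdsumE scalerDr. Qed.
Lemma dsum_scaleDl x : {morph dsum_scale^~ x : a b / a + b}.
Proof. by move=> a b; apply/dsumP=> i; rewrite !mkdsumE scalerDl. Qed.
HB.instance Definition _ := GRing.Zmodule_isLmodule.Build K (dsum V)
  dsum_scaleA dsum_scale1 dsum_scaleDr dsum_scaleDl.

Lemma dproj_is_linear i : linear (dproj i).
Proof. by move=> a x y; rewrite !mkdsumE. Qed.
HB.instance Definition _ i :=
  GRing.isLinear.Build K (dsum V) (V i) _ (dproj i) (dproj_is_linear i).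

Lemma dsum_vect_iso :
  Vector.axiom (\sum_(i < n) \dim {: V i})%N (dsum V).
Proof.
exists (fun x => \mxrow_(i < n) rVof (vbasis {: V i}) (dproj i x)).
  move=> a x y; apply/mxrowP=> i.
  rewrite submxrowD !mxrowK linearP linearP /=; congr (_ + _).
  rewrite -[in LHS](mxrowK (fun j => rVof (vbasis {: V j}) (dproj j x)) i).
  by apply/rowP=> k; rewrite !mxE.
exists (fun w => mkdsum (fun i => vecof (vbasis {: V i}) (submxrow w i))).
  by move=> x; apply/dsumP=> i; rewrite mkdsumE mxrowK rVofK // vbasisP.
move=> w; apply/mxrowP=> i; rewrite mxrowK mkdsumE vecofK //.
exact: vbasisP.
Qed.
HB.instance Definition _ := Lmodule_hasFinDim.Build K (dsum V) dsum_vect_iso.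

End DirectSum.

Definition tmul (K : fieldType) (A : falgType K) (s t : tensor A A) :
    tensor A A :=
  tlift (fun a b => tlift (fun c d => (a * c) \ox (b * d)) t) s.

HB.mixin Record Falgebra_isHopf (K : fieldType) H of Falgebra K H := {
  comul : 'Hom(H, tensor H H);
  counit : 'Hom(H, K^o);
  antipode : 'End(H);
  comulA : forall h : H,
    tassoc (tmap comul idfun (comul h)) = tmap idfun comul (comul h);
  counitl : forall h : H, tlift (fun a b => (counit a : K) *: b) (comul h) = h;
  counitr : forall h : H, tlift (fun a b => (counit b : K) *: a) (comul h) = h;
  comul1 : comul 1 = 1 \ox 1;
  comulM : forall g h : H, comul (g * h) = tmul (comul g) (comul h);
  counit1 : counit 1 = 1;
  counitM : forall g h : H, counit (g * h) = counit g * counit h;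
  antipodel : forall h : H,
    tlift (fun a b => antipode a * b) (comul h) = (counit h : K) *: 1;
  antipoder : forall h : H,
    tlift (fun a b => a * antipode b) (comul h) = (counit h : K) *: 1
}.

#[short(type="hopfAlgType")]
HB.structure Definition HopfAlgebra (K : fieldType) :=
  { H of Falgebra_isHopf K H & Falgebra K H }.

Definition lftrace (K : fieldType) (V : vectType K) (f : 'End(V)) : K :=
  \tr (mxof (vbasis fullv) (vbasis fullv) f).

Section Indicator.
Variables (K : fieldType) (H : hopfAlgType K).

Definition conv (f g : 'End(H)) : 'End(H) :=
  linfun (fun h => tlift (fun a b => f a * g b) (comul h)).

Definition conv1 : 'End(H) := linfun (fun h => (counit h : K) *: 1).

Definition convpow (m : nat) : 'End(H) := iter m (conv \1) conv1.

(* Meant for n >= 1. *)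
Definition nu (n : nat) : K := lftrace (antipode \o convpow n.-1).

End Indicator.

Record filtration (K : fieldType) (V : vectType K) := Filtration {
  filt :> nat -> {vspace V};
  filt_mono : forall n, (filt n <= filt n.+1)%VS;
  filt_exhaustive : forall v : V, exists n, v \in filt n
}.

Section Graded.
Variables (K : fieldType) (V : vectType K) (F : filtration V).

Definition filt_prev (n : nat) : {vspace V} := if n is m.+1 then F m else 0%VS.

Lemma filt_le m n : (m <= n)%N -> (F m <= F n)%VS.
Proof.
by move=> /subnKC <-; elim: (n - m)%N => [|p IH]; rewrite ?addn0 // addnS (subv_trans IH) ?filt_mono.
Qed.

Lemma filt_topP : exists n, F n == fullv.
Proof.
pose N := \max_(i < \dim {:V}) ex_minn (filt_exhaustive F (vbasis fullv)`_i).
exists N; rewrite eqEsubv subvf; apply/subvP=> v vV.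
rewrite (coord_vbasis vV) memv_suml // => i _; apply: memvZ.
have : (ex_minn (filt_exhaustive F (vbasis fullv)`_i) <= N)%N by exact: leq_bigmax.
by case: ex_minnP => m mP _ /filt_le/subvP; apply.
Qed.

(* The least N such that F N is the whole space: the pieces F n / F n.-1 with *)
(* N < n are zero (filt_prev_top), so the direct sum over n of all pieces is  *)
(* the sum of those with n <= N.                                              *)
Definition filt_top : nat := ex_minn filt_topP.

Lemma filt_topE n : (filt_top <= n)%N -> F n = fullv.
Proof.
rewrite /filt_top; case: ex_minnP => N /eqP FN _ /filt_le; rewrite FN => FS.
by apply/eqP; rewrite eqEsubv subvf.
Qed.

Lemma filt_prev_top n : (filt_top < n)%N -> filt_prev n = F n.
Proof. by case: n => // n leN; rewrite /= !filt_topE // ltnW. Qed.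

Lemma filt_prevS n : (filt_prev n <= F n)%VS.
Proof. by case: n => [|n]; rewrite ?sub0v ?filt_mono. Qed.

Lemma filt_prev_lt m n : (m < n)%N -> (F m <= filt_prev n)%VS.
Proof. by case: n => // n; rewrite ltnS; apply: filt_le. Qed.

(* F n / F n.-1, with F (-1) = 0; filt_prev n is taken inside F n. *)
Definition gr_part (n : nat) : vectType K :=
  quotv (linfun (@vsval K V (F n)) @^-1: filt_prev n)%VS.

Definition gr : Type := dsum (fun i : 'I_filt_top.+1 => gr_part i).
HB.instance Definition _ := Vector.copy gr
  (dsum (fun i : 'I_filt_top.+1 => gr_part i)).

(* The class in F n / F n.-1 of a vector v of F n, as an element of gr. (For  *)
(* v outside F n, the value depends on the projection vsproj.)                *)
Definition symbol (n : nat) (v : V) : gr :=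
  mkdsum (fun i : 'I_filt_top.+1 =>
    if n == i then piv _ (vsproj (F i) v) else 0 : gr_part i).

(* A representative in F n of the component of x in F n / F n.-1.             *)
Definition gr_repr (i : 'I_filt_top.+1) (x : gr) : V :=
  vsval (reprv (dproj i x)).

(* The map on gr induced by maps f n : F n -> W that vanish on F n.-1;        *)
(* gr_lift_symbol shows that the choice of representatives does not matter.   *)
Definition gr_lift (W : vectType K) (f : nat -> V -> W) (x : gr) : W :=
  \sum_(i < filt_top.+1) f i (gr_repr i x).

Lemma gr_repr_mem i x : gr_repr i x \in F i.
Proof. exact: subvsP. Qed.

Lemma piv_filt n v : v \in F n ->
  (piv (linfun (@vsval K V (F n)) @^-1: filt_prev n)%VS (vsproj (F n) v) == 0)
    = (v \in filt_prev n).
Proof. by move=> vF; rewrite piv_eq0 -memv_preim lfunE /= vsprojK. Qed.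

Lemma symbol_is_linear n : linear (symbol n).
Proof.
move=> a u v; apply/dsumP=> i; rewrite linearP /= !mkdsumE.
by case: eqP => // _; rewrite ?linearP // scaler0 addr0.
Qed.
HB.instance Definition _ n :=
  GRing.isLinear.Build K V gr _ (symbol n) (symbol_is_linear n).

Lemma symbol_prev n v : v \in filt_prev n -> symbol n v = 0.
Proof.
move=> vF; apply/dsumP=> i; rewrite linear0 mkdsumE; case: eqP => // ni.
by apply/eqP; rewrite piv_filt -ni // (subvP (filt_prevS n)).
Qed.

Lemma symbol_lt m n v : (m < n)%N -> v \in F m -> symbol n v = 0.
Proof. by move=> mn vF; apply: symbol_prev; apply: subvP vF; apply: filt_prev_lt. Qed.

Lemma gr_reprP (i : 'I_filt_top.+1) v x : v \in F i ->
  dproj i x = piv _ (vsproj (F i) v) -> gr_repr i x - v \in filt_prev i.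
Proof.
move=> vF xv; rewrite -piv_filt ?memvB ?gr_repr_mem // linearB /= linearB /=.
by rewrite /gr_repr vsvalK reprvK xv subrr.
Qed.

Lemma symbolK (i : 'I_filt_top.+1) v : v \in F i ->
  gr_repr i (symbol i v) - v \in filt_prev i.
Proof. by move=> vF; apply: gr_reprP; rewrite // mkdsumE eqxx. Qed.

Lemma gr_reprK x : \sum_(i < filt_top.+1) symbol i (gr_repr i x) = x.
Proof.
apply/dsumP=> j; rewrite linear_sum (bigD1 j) //= big1 ?addr0.
  by rewrite mkdsumE eqxx /gr_repr vsvalK reprvK.
by move=> i /negPf ij; rewrite mkdsumE val_eqE ij.
Qed.

Lemma gr_ind (P : gr -> Prop) :
  P 0 -> (forall x y, P x -> P y -> P (x + y)) ->
  (forall n v, v \in F n -> P (symbol n v)) -> forall x, P x.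
Proof.
move=> P0 PD Ps x; rewrite -(gr_reprK x); elim/big_rec: _ => // i y _.
by apply: (PD); apply/Ps/gr_repr_mem.
Qed.

Section Lift.
Variables (W : vectType K) (f : nat -> V -> W).
Hypothesis f_lin : forall n, linear (f n).
Hypothesis f_prev : forall n v, v \in filt_prev n -> f n v = 0.

Let f_eq n u v : u - v \in filt_prev n -> f n u = f n v.
Proof.
move=> uv; rewrite -[u](subrK v) -[u - v]scale1r f_lin f_prev //.
by rewrite scaler0 add0r.
Qed.

Lemma gr_lift_is_linear : linear (gr_lift f).
Proof.
move=> a x y; rewrite /gr_lift scaler_sumr -big_split; apply: eq_bigr => i _.
rewrite /= -f_lin; apply: f_eq; apply: gr_reprP.
  by rewrite memvD ?memvZ ?gr_repr_mem.
by rewrite !linearP /= /gr_repr !vsvalK !reprvK.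
Qed.

Lemma gr_lift_symbol n v : v \in F n -> gr_lift f (symbol n v) = f n v.
Proof.
have [nN | Nn] := ltnP n filt_top.+1; last first.
  move=> vF; rewrite -filt_prev_top // in vF.
  rewrite (f_prev vF) symbol_prev //.
  by have := gr_lift_is_linear (-1) 0 0; rewrite scaler0 addr0 scaleN1r addNr.
move=> vF; rewrite /gr_lift (bigD1 (Ordinal nN)) //= big1 ?addr0.
  by apply/f_eq/(symbolK (i := Ordinal nN)).
move=> i ni; apply: f_prev; rewrite -[gr_repr _ _]subr0.
apply: gr_reprP; rewrite ?mem0v // linear0 linear0 mkdsumE.
by rewrite ifN // eq_sym.
Qed.
End Lift.

End Graded.

(* No condition on the counit: every linear map to K is filtered, since K is  *)
(* placed in degree 0 (all the terms of its filtration are K).                *)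
Record hopfFiltration (K : fieldType) (H : hopfAlgType K) := HopfFiltration {
  hopf_filt :> filtration H;
  hopf_filt1 : 1 \in hopf_filt 0;
  hopf_filtM : forall i j, (hopf_filt i * hopf_filt j <= hopf_filt (i + j)%N)%VS;
  hopf_filt_comul : forall n, (comul @: hopf_filt n <=
    \sum_(i < n.+1) tensv (hopf_filt i) (hopf_filt (n - i)%N))%VS;
  hopf_filt_antipode : forall n, (antipode @: hopf_filt n <= hopf_filt n)%VS
}.

Section GrHopf.
Variables (K : fieldType) (H : hopfAlgType K) (F : hopfFiltration H).
Local Notation sym := (symbol F).

Definition gr_one : gr F := sym 0 1.

Definition gr_mul (x y : gr F) : gr F :=
  gr_lift (fun i a => gr_lift (fun j b => sym (i + j) (a * b)) y) x.

(* The component F n -> F i / F i.-1 (x) F (n - i) / F (n - i).-1 of the map  *)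
(* induced by comul is well defined although symbol depends on a projection   *)
(* outside F i: see gr_tens_tens and gr_tens_lt.                              *)
Definition gr_tens (n : nat) : tensor H H -> tensor (gr F) (gr F) :=
  fun t => \sum_(i < n.+1) tmap (sym i) (sym (n - i)) t.

Definition gr_comul : 'Hom(gr F, tensor (gr F) (gr F)) :=
  linfun (gr_lift (fun n h => gr_tens n (comul h))).

Definition gr_counit : 'Hom(gr F, K^o) :=
  linfun (gr_lift (fun n h => if n == 0%N then counit h else 0)).

Definition gr_antipode : 'End(gr F) :=
  linfun (gr_lift (fun n h => sym n (antipode h))).

Let linfunE (U W : vectType K) (f : U -> W) : linear f -> linfun f =1 f.
Proof.
move=> fl; pose fM := GRing.isLinear.Build _ _ _ _ f fl.
pose g : {linear U -> W} := HB.pack f fM.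
by move=> u; rewrite (lfunE g).
Qed.

Definition tfilt (n : nat) : {vspace tensor H H} :=
  (\sum_(i < n.+1) tensv (F i) (F (n - i)%N))%VS.

Lemma tfilt_ind n (P : tensor H H -> Prop) :
  P 0 -> (forall s t, P s -> P t -> P (s + t)) ->
  (forall i j a b, (i + j = n)%N -> a \in F i -> b \in F j -> P (a \ox b)) ->
  forall t, t \in tfilt n -> P t.
Proof.
move=> P0 PD Pt t /memv_sumP[f fF ->]; elim/big_rec: _ => // i s _.
apply: (PD); move: (fF i isT); apply: tensv_ind => // a b aF bF.
by apply: Pt aF bF; rewrite subnKC // -ltnS.
Qed.

Lemma comul_tfilt n h : h \in F n -> comul h \in tfilt n.
Proof. by move=> hF; apply: (subvP (hopf_filt_comul F n)); apply: memv_img. Qed.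

Lemma mul_filt i j a b : a \in F i -> b \in F j -> a * b \in F (i + j)%N.
Proof. by move=> aF bF; apply: (subvP (hopf_filtM F i j)); apply: memv_mul. Qed.

Lemma antipode_filt n h : h \in F n -> antipode h \in F n.
Proof. by move=> hF; apply: (subvP (hopf_filt_antipode F n)); apply: memv_img. Qed.

Lemma gr_mul_cond_r i a : a \in F i ->
  (forall j, linear (fun b => sym (i + j) (a * b))) /\
  (forall j b, b \in filt_prev F j -> sym (i + j) (a * b) = 0).
Proof.
move=> aF; split=> [j c b1 b2 | j b].
  by rewrite mulrDr -scalerAr linearP.
case: j => [|j]; first by rewrite memv0 => /eqP->; rewrite mulr0 linear0.
by move=> bF; apply: (@symbol_lt _ _ _ (i + j)); rewrite ?addnS ?ltnS // mul_filt.
Qed.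

Lemma gr_mul_cond_l (y : gr F) :
  let f i a := gr_lift (fun j b => sym (i + j) (a * b)) y in
  (forall i, linear (f i)) /\ (forall i a, a \in filt_prev F i -> f i a = 0).
Proof.
split=> [i c a1 a2 | [|i] a].
- rewrite /gr_lift scaler_sumr -big_split; apply: eq_bigr => j _ /=.
  by rewrite mulrDl -scalerAl linearP.
- by rewrite memv0 => /eqP->; apply: big1 => j _; rewrite mul0r linear0.
move=> aF; apply: big1 => j _.
by apply: (@symbol_lt _ _ _ (i + j)); rewrite ?addSn ?ltnS // mul_filt ?gr_repr_mem.
Qed.

Lemma gr_mul_bilin : bilin gr_mul.
Proof.
split=> [y|x]; first by apply: gr_lift_is_linear; case: (gr_mul_cond_l y).
move=> c y1 y2; rewrite /gr_mul {1 3 5}/gr_lift scaler_sumr -big_split.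
apply: eq_bigr => i _ /=.
by apply: gr_lift_is_linear; case: (gr_mul_cond_r (gr_repr_mem i x)).
Qed.

Lemma gr_mul_symbol i j a b : a \in F i -> b \in F j ->
  gr_mul (sym i a) (sym j b) = sym (i + j) (a * b).
Proof.
move=> aF bF; have [fl fp] := gr_mul_cond_l (sym j b).
rewrite /gr_mul (gr_lift_symbol fl fp aF).
by case: (gr_mul_cond_r aF) => gl gp; rewrite (gr_lift_symbol gl gp bF).
Qed.

Lemma one_filt n : 1 \in F n.
Proof. by apply: (subvP (filt_le F (leq0n n))); apply: hopf_filt1. Qed.

Lemma gr_mulA : associative gr_mul.
Proof.
move=> x y z; have mB := gr_mul_bilin.
elim/gr_ind: x => [|x1 x2 IH1 IH2|i a aF].
- by rewrite !(bilin0l _ mB).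
- by rewrite !(bilinDl _ _ _ mB) IH1 IH2.
elim/gr_ind: y => [|y1 y2 IH1 IH2|j b bF].
- by rewrite !(bilin0l _ mB, bilin0r _ mB).
- by rewrite (bilinDl _ _ _ mB) !(bilinDr _ _ _ mB) (bilinDl _ _ _ mB) IH1 IH2.
elim/gr_ind: z => [|z1 z2 IH1 IH2|k c cF].
- by rewrite !(bilin0r _ mB).
- by rewrite !(bilinDr _ _ _ mB) IH1 IH2.
by rewrite !gr_mul_symbol ?mul_filt // addnA mulrA.
Qed.

Lemma gr_mul1l : left_id gr_one gr_mul.
Proof.
move=> x; have mB := gr_mul_bilin.
elim/gr_ind: x => [|x1 x2 IH1 IH2|i a aF].
- by rewrite !(bilin0r _ mB).
- by rewrite !(bilinDr _ _ _ mB) IH1 IH2.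
by rewrite gr_mul_symbol ?one_filt // mul1r.
Qed.

Lemma gr_mul1r : right_id gr_one gr_mul.
Proof.
move=> x; have mB := gr_mul_bilin.
elim/gr_ind: x => [|x1 x2 IH1 IH2|i a aF].
- by rewrite !(bilin0l _ mB).
- by rewrite !(bilinDl _ _ _ mB) IH1 IH2.
by rewrite gr_mul_symbol ?one_filt // mulr1 addn0.
Qed.

Lemma gr_mulDl : left_distributive gr_mul +%R.
Proof. by move=> x y z; rewrite (bilinDl _ _ _ gr_mul_bilin). Qed.
Lemma gr_mulDr : right_distributive gr_mul +%R.
Proof. by move=> x y z; rewrite (bilinDr _ _ _ gr_mul_bilin). Qed.

Lemma gr_one_neq0 : gr_one != 0.
Proof.
apply/eqP => e; have := @symbolK _ _ F ord0 1 (one_filt 0).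
rewrite -/gr_one -[gr_one]/(sym 0 1) in e *; rewrite e.
have := @symbolK _ _ F ord0 0 (mem0v _); rewrite linear0 subr0 => r0.
by move=> r1; have := memvB r0 r1; rewrite opprB addrC subrK memv0 oner_eq0.
Qed.

HB.instance Definition _ := GRing.Zmodule_isNzRing.Build (gr F)
  gr_mulA gr_mul1l gr_mul1r gr_mulDl gr_mulDr gr_one_neq0.

Lemma gr_scaleAl (a : K) (x y : gr F) : a *: (x * y) = (a *: x) * y.
Proof. by rewrite [RHS](bilinZl _ _ _ gr_mul_bilin). Qed.
HB.instance Definition _ := GRing.Lmodule_isLalgebra.Build K (gr F) gr_scaleAl.

Lemma gr_scaleAr (a : K) (x y : gr F) : a *: (x * y) = x * (a *: y).
Proof. by rewrite [RHS](bilinZr _ _ _ gr_mul_bilin). Qed.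
HB.instance Definition _ := GRing.Lalgebra_isAlgebra.Build K (gr F) gr_scaleAr.

HB.instance Definition _ := Algebra_isFalgebra.Build K (gr F).

Lemma symbolM i j a b : a \in F i -> b \in F j ->
  sym i a * sym j b = sym (i + j) (a * b).
Proof. exact: gr_mul_symbol. Qed.

Lemma symbol1 : sym 0 1 = 1. Proof. by []. Qed.

Lemma gr_tens_is_linear n : linear (gr_tens n).
Proof.
move=> a s t; rewrite /gr_tens scaler_sumr -big_split.
by apply: eq_bigr => i _; rewrite linearP.
Qed.
HB.instance Definition _ n :=
  GRing.isLinear.Build K _ _ _ (gr_tens n) (gr_tens_is_linear n).

Lemma gr_tens_tens i j a b : a \in F i -> b \in F j ->
  gr_tens (i + j) (a \ox b) = sym i a \ox sym j b.
Proof.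
move=> aF bF; have iS : (i < (i + j).+1)%N by rewrite ltnS leq_addr.
rewrite /gr_tens (bigD1 (Ordinal iS)) //= big1 ?addr0 => [|p].
  by rewrite tmap_tens addKn.
rewrite tmap_tens -val_eqE neq_ltn /= => /orP[pi|ip].
  by rewrite [X in _ \ox X](symbol_lt _ bF) ?tens0r // ltn_subRL ltn_add2r.
by rewrite (symbol_lt ip aF) tens0l.
Qed.

Lemma gr_tens_lt m n t : (m < n)%N -> t \in tfilt m -> gr_tens n t = 0.
Proof.
move=> mn; apply: (tfilt_ind (P := fun t => gr_tens n t = 0)) =>
  [|s u s0 u0|i j a b ij aF bF].
- exact: linear0.
- by rewrite linearD /= s0 u0 addr0.
rewrite /gr_tens big1 // => p _; rewrite tmap_tens /=.
have [ip|pi] := ltnP i p; first by rewrite (symbol_lt ip aF) tens0l.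
rewrite [X in _ \ox X](symbol_lt _ bF) ?tens0r // ltn_subRL.
by apply: leq_ltn_trans mn; rewrite -ij leq_add2r.
Qed.

Lemma filt_prev_gt0 n h : h \in filt_prev F n ->
  h = 0 \/ exists2 m, n = m.+1 & h \in F m.
Proof.
by case: n => [|n hF]; [rewrite memv0 => /eqP; left | right; exists n].
Qed.

Let gr_comul_lin n : linear (fun h => gr_tens n (comul h)).
Proof. by move=> a x y; rewrite !linearP. Qed.
Let gr_comul_prev n h : h \in filt_prev F n -> gr_tens n (comul h) = 0.
Proof.
case/filt_prev_gt0 => [->|[m -> hF]]; first by rewrite !linear0.
by apply: (@gr_tens_lt m); rewrite ?comul_tfilt.
Qed.

Lemma gr_comul_symbol n h : h \in F n ->
  gr_comul (sym n h) = gr_tens n (comul h).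
Proof.
move=> hF; rewrite linfunE ?(gr_lift_symbol gr_comul_lin gr_comul_prev hF) //.
exact: gr_lift_is_linear gr_comul_lin gr_comul_prev.
Qed.

Lemma gr_counit_symbol n h : h \in F n ->
  gr_counit (sym n h) = if n == 0%N then counit h else 0.
Proof.
pose f (n : nat) (h : H) : K^o := if n == 0%N then counit h else 0.
have fl k : linear (f k).
  by move=> a x y; rewrite /f; case: eqP; rewrite ?linearP // scaler0 addr0.
have fp k v : v \in filt_prev F k -> f k v = 0.
  by case/filt_prev_gt0 => [->|[m -> _]] //; rewrite /f linear0 if_same.
move=> hF; rewrite linfunE ?(gr_lift_symbol fl fp hF) //.
exact: gr_lift_is_linear fl fp.
Qed.

Lemma gr_antipode_symbol n h : h \in F n ->
  gr_antipode (sym n h) = sym n (antipode h).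
Proof.
pose f n (h : H) := sym n (antipode h).
have fl k : linear (f k) by move=> a x y; rewrite /f !linearP.
have fp k v : v \in filt_prev F k -> f k v = 0.
  case/filt_prev_gt0 => [->|[m -> vF]]; first by rewrite /f !linear0.
  by apply: (@symbol_lt _ _ _ m); rewrite ?antipode_filt.
move=> hF; rewrite linfunE ?(gr_lift_symbol fl fp hF) //.
exact: gr_lift_is_linear fl fp.
Qed.

End GrHopf.

Section GrHopfAxioms.
Variables (K : fieldType) (H : hopfAlgType K) (F : hopfFiltration H).
Local Notation sym := (symbol F).

Lemma gr_linear_ext (W : vectType K) (f g : {linear gr F -> W}) :
  (forall n h, h \in F n -> f (sym n h) = g (sym n h)) -> f =1 g.
Proof.
move=> fg; apply: gr_ind => [|x y fx fy|//]; first by rewrite !linear0.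
by rewrite !linearD fx fy.
Qed.

Lemma symbol_scale1 n (c : K) : sym n (c *: 1) = if n == 0%N then c *: 1 else 0.
Proof.
case: n => [|n]; first by rewrite linearZ.
by rewrite (@symbol_lt _ _ _ 0) ?memvZ ?one_filt.
Qed.

Lemma bilin_linear (U V W : vectType K) (f : {linear U -> K^o})
  (g : {linear V -> W}) : bilin (fun u v => (f u : K) *: g v).
Proof.
split=> [v|u] a x y; first by rewrite linearP scalerDl -scalerA.
by rewrite linearP scalerDr !scalerA mulrC.
Qed.

Lemma bilin_linear_r (U V W : vectType K) (f : {linear V -> K^o})
  (g : {linear U -> W}) : bilin (fun u v => (f v : K) *: g u).
Proof.
split=> [v|u] a x y; last by rewrite linearP scalerDl -scalerA.
by rewrite linearP scalerDr !scalerA mulrC.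
Qed.

Lemma bilin_mul (A B C : falgType K) (f : {linear A -> C}) (g : {linear B -> C}) :
  bilin (fun a b => f a * g b).
Proof.
split=> [v|u] a x y; first by rewrite linearP mulrDl -scalerAl.
by rewrite linearP mulrDr -scalerAr.
Qed.

Lemma tlift_gr_tens (f : H -> H -> H) (g : gr F -> gr F -> gr F) n t :
  bilin f -> bilin g ->
  (forall i j a b, a \in F i -> b \in F j ->
    g (sym i a) (sym j b) = sym (i + j) (f a b)) ->
  t \in tfilt F n -> tlift g (gr_tens F n t) = sym n (tlift f t).
Proof.
move=> fB gB fg; move: t.
apply: (tfilt_ind (P := fun t => tlift g (gr_tens F n t) = sym n (tlift f t)))
  => [|s u IHs IHu|i j a b <- aF bF].
- by rewrite !linear0.
- by rewrite !linearD /= IHs IHu.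
by rewrite gr_tens_tens // !tlift_tens // fg.
Qed.

Lemma gr_counitl (x : gr F) :
  tlift (fun a b => (gr_counit F a : K) *: b) (gr_comul F x) = x.
Proof.
have B := bilin_linear (gr_counit F) (@idfun (gr F)).
have B' := bilin_linear (counit : {linear H -> K^o}) (@idfun H).
pose f : {linear gr F -> gr F} := tlift (fun a b => (gr_counit F a : K) *: b) \o gr_comul F.
move: x; apply: (gr_linear_ext (f := f) (g := idfun)) => n h hF /=.
rewrite gr_comul_symbol // (tlift_gr_tens B' B) ?comul_tfilt ?counitl //.
move=> i j a b aF bF; rewrite /= gr_counit_symbol // linearZ /=.
case: i aF => [//|i] aF; rewrite scale0r (@symbol_lt _ _ _ j) ?scaler0 //.
by rewrite addSn ltnS leq_addl.
Qed.

Lemma gr_counitr (x : gr F) :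
  tlift (fun a b => (gr_counit F b : K) *: a) (gr_comul F x) = x.
Proof.
have B := bilin_linear_r (gr_counit F) (@idfun (gr F)).
have B' := bilin_linear_r (counit : {linear H -> K^o}) (@idfun H).
pose f : {linear gr F -> gr F} := tlift (fun a b => (gr_counit F b : K) *: a) \o gr_comul F.
move: x; apply: (gr_linear_ext (f := f) (g := idfun)) => n h hF /=.
rewrite gr_comul_symbol // (tlift_gr_tens B' B) ?comul_tfilt ?counitr //.
move=> i j a b aF bF; rewrite /= gr_counit_symbol // linearZ /=.
case: j bF => [|j] bF; first by rewrite addn0.
rewrite scale0r (@symbol_lt _ _ _ i) ?scaler0 //.
by rewrite addnS ltnS leq_addr.
Qed.

Lemma gr_counit_scale1 n h : h \in F n ->
  (gr_counit F (sym n h) : K) *: (1 : gr F) = sym n ((counit h : K) *: 1).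
Proof.
by move=> hF; rewrite gr_counit_symbol // symbol_scale1; case: eqP; rewrite ?scale0r.
Qed.

Lemma gr_antipodel (x : gr F) :
  tlift (fun a b => gr_antipode F a * b) (gr_comul F x)
    = (gr_counit F x : K) *: 1.
Proof.
have B := bilin_mul (gr_antipode F) (@idfun (gr F)).
have B' := bilin_mul (antipode : {linear H -> H}) (@idfun H).
elim/gr_ind: x => [|x y IHx IHy|n h hF].
- by rewrite !linear0 scale0r.
- by rewrite !linearD /= IHx IHy scalerDl.
rewrite gr_comul_symbol // (tlift_gr_tens B' B) ?comul_tfilt //.
  by rewrite gr_counit_scale1 // -antipodel.
by move=> i j a b aF bF; rewrite /= gr_antipode_symbol // symbolM ?antipode_filt.
Qed.

Lemma gr_antipoder (x : gr F) :
  tlift (fun a b => a * gr_antipode F b) (gr_comul F x)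
    = (gr_counit F x : K) *: 1.
Proof.
have B := bilin_mul (@idfun (gr F)) (gr_antipode F).
have B' := bilin_mul (@idfun H) (antipode : {linear H -> H}).
elim/gr_ind: x => [|x y IHx IHy|n h hF].
- by rewrite !linear0 scale0r.
- by rewrite !linearD /= IHx IHy scalerDl.
rewrite gr_comul_symbol // (tlift_gr_tens B' B) ?comul_tfilt //.
  by rewrite gr_counit_scale1 // -antipoder.
by move=> i j a b aF bF; rewrite /= gr_antipode_symbol // symbolM ?antipode_filt.
Qed.

Lemma gr_comul1 : gr_comul F 1 = 1 \ox 1.
Proof.
rewrite -!symbol1 gr_comul_symbol ?one_filt // comul1.
by rewrite -[0%N in LHS]/(0 + 0)%N gr_tens_tens ?one_filt.
Qed.

Lemma gr_counit1 : gr_counit F 1 = 1.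
Proof. by rewrite -symbol1 gr_counit_symbol ?one_filt // counit1. Qed.

Lemma gr_counitM (x y : gr F) : gr_counit F (x * y) = gr_counit F x * gr_counit F y.
Proof.
elim/gr_ind: x => [|x1 x2 IH1 IH2|i a aF].
- by rewrite mul0r linear0 mul0r.
- by rewrite mulrDl !linearD /= IH1 IH2 mulrDl.
elim/gr_ind: y => [|y1 y2 IH1 IH2|j b bF].
- by rewrite mulr0 linear0 mulr0.
- by rewrite mulrDr !linearD /= IH1 IH2 mulrDr.
rewrite symbolM // !gr_counit_symbol ?mul_filt // addn_eq0 counitM.
by case: (i == _); case: (j == _); rewrite /= ?mul0r ?mulr0.
Qed.

Let tmul_bilin_r (A : falgType K) (a b : A) :
  bilin (fun c d : A => (a * c) \ox (b * d)).
Proof.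
by split=> [w|w] e x y; rewrite mulrDr -scalerAr ?(tensDl, tensZl, tensDr, tensZr).
Qed.

Let tmul_bilin_l (A : falgType K) (t : tensor A A) :
  bilin (fun a b : A => tlift (fun c d => (a * c) \ox (b * d)) t).
Proof.
have B := @tmul_bilin_r A.
split=> [w e x y|w e x y]; elim/tensor_ind: t => [|s1 s2 IH1 IH2|u v].
- by rewrite !linear0 ?scaler0 addr0.
- by rewrite !linearD /= IH1 IH2 ?scalerDr addrACA.
- by rewrite !tlift_tens // mulrDl -scalerAl tensDl tensZl.
- by rewrite !linear0 ?scaler0 addr0.
- by rewrite !linearD /= IH1 IH2 ?scalerDr addrACA.
by rewrite !tlift_tens // mulrDl -scalerAl tensDr tensZr.
Qed.

Lemma tmul_tens (A : falgType K) (a b c d : A) :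
  tmul (a \ox b) (c \ox d) = (a * c) \ox (b * d).
Proof.
rewrite /tmul tlift_tens; last exact: tmul_bilin_l.
by rewrite tlift_tens //; apply: tmul_bilin_r.
Qed.

Lemma tmul_bilin (A : falgType K) : bilin (@tmul K A).
Proof.
split=> [t|s]; first exact: tlift_is_linear.
move=> a t1 t2; elim/tensor_ind: s => [|s1 s2 IH1 IH2|u v].
- by rewrite /tmul !linear0 ?scaler0 addr0.
- by move: IH1 IH2; rewrite /tmul !linearD /= => -> ->; rewrite ?scalerDr addrACA.
rewrite /tmul !tlift_tens; first exact: linearP.
all: exact: tmul_bilin_l.
Qed.

Lemma gr_tensM m n s t : s \in tfilt F m -> t \in tfilt F n ->
  gr_tens F (m + n) (tmul s t) = tmul (gr_tens F m s) (gr_tens F n t).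
Proof.
move=> sF tF; have BH := @tmul_bilin H; have BG := @tmul_bilin (gr F).
move: s sF; apply: (tfilt_ind (P := fun s => gr_tens F (m + n) (tmul s t) =
  tmul (gr_tens F m s) (gr_tens F n t))) => [|s u IHs IHu|i j a b <- aF bF].
- by rewrite linear0 (bilin0l _ BH) (bilin0l _ BG) linear0.
- by rewrite (bilinDl _ _ _ BH) !linearD /= IHs IHu (bilinDl _ _ _ BG).
move: t tF; apply: (tfilt_ind (P := fun t => gr_tens F (i + j + n) (tmul _ t) =
  tmul _ (gr_tens F n t))) => [|s u IHs IHu|k l c d <- cF dF].
- by rewrite linear0 (bilin0r _ BH) (bilin0r _ BG) linear0.
- by rewrite (bilinDr _ _ _ BH) !linearD /= IHs IHu (bilinDr _ _ _ BG).
rewrite tmul_tens addnACA !gr_tens_tens ?mul_filt // tmul_tens.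
by rewrite !symbolM.
Qed.

Lemma gr_comulM (x y : gr F) :
  gr_comul F (x * y) = tmul (gr_comul F x) (gr_comul F y).
Proof.
have BG := @tmul_bilin (gr F).
elim/gr_ind: x => [|x1 x2 IH1 IH2|i a aF].
- by rewrite mul0r linear0 (bilin0l _ BG).
- by rewrite mulrDl !linearD /= IH1 IH2 (bilinDl _ _ _ BG).
elim/gr_ind: y => [|y1 y2 IH1 IH2|j b bF].
- by rewrite mulr0 linear0 (bilin0r _ BG).
- by rewrite mulrDr !linearD /= IH1 IH2 (bilinDr _ _ _ BG).
by rewrite symbolM // !gr_comul_symbol ?mul_filt // comulM gr_tensM ?comul_tfilt.
Qed.

Let sym3 n : tensor H (tensor H H) -> tensor (gr F) (tensor (gr F) (gr F)) :=
  fun t => \sum_(i < n.+1) tmap (sym i) (gr_tens F (n - i)) t.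

Let sym3_lin n : linear (sym3 n).
Proof.
move=> a s t; rewrite /sym3 scaler_sumr -big_split.
by apply: eq_bigr => i _; rewrite linearP.
Qed.

Let sym30 n : sym3 n 0 = 0.
Proof. by rewrite /sym3 big1 // => i _; rewrite linear0. Qed.
Let sym3D n s t : sym3 n (s + t) = sym3 n s + sym3 n t.
Proof. by have := sym3_lin n 1 s t; rewrite !scale1r. Qed.

Let sym3_tens i m a s : a \in F i -> s \in tfilt F m ->
  sym3 (i + m) (a \ox s) = sym i a \ox gr_tens F m s.
Proof.
move=> aF sF; have iS : (i < (i + m).+1)%N by rewrite ltnS leq_addr.
rewrite /sym3 (bigD1 (Ordinal iS)) //= big1 ?addr0 => [|p].
  by rewrite tmap_tens /= addKn.
rewrite tmap_tens -val_eqE neq_ltn /= => /orP[pi|ip].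
  by rewrite (gr_tens_lt _ sF) ?tens0r // ltn_subRL ltn_add2r.
by rewrite (symbol_lt ip aF) tens0l.
Qed.

Lemma gr_comulA (x : gr F) :
  tassoc (tmap (gr_comul F) idfun (gr_comul F x))
    = tmap idfun (gr_comul F) (gr_comul F x).
Proof.
elim/gr_ind: x => [|x y IHx IHy|n h hF]; first by rewrite !linear0.
  by rewrite !linearD /= IHx IHy.
rewrite gr_comul_symbol //; have := comul_tfilt hF; move: (comulA h).
move: (comul h) => t tA tF.
transitivity (sym3 n (tmap idfun comul t)).
  rewrite -tA; move: t tF {tA}.
  apply: (tfilt_ind (P := fun t => tassoc (tmap _ idfun (gr_tens F n t)) =
    sym3 n (tassoc (tmap comul idfun t)))) => [|s u IHs IHu|i j a b <- aF bF].
  - by rewrite !linear0 sym30.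
  - by rewrite !linearD /= sym3D IHs IHu.
  rewrite gr_tens_tens // !tmap_tens /= gr_comul_symbol //.
  move: (comul a) (comul_tfilt aF).
  apply: (tfilt_ind (P := fun s => tassoc (gr_tens F i s \ox _) =
    sym3 (i + j) (tassoc (s \ox b)))) => [|s u IHs IHu|k l c d <- cF dF].
  - by rewrite linear0 !tens0l !linear0 sym30.
  - by rewrite linearD /= !tensDl !linearD /= sym3D IHs IHu.
  rewrite gr_tens_tens // !tassoc_tens -addnA sym3_tens ?gr_tens_tens //.
  rewrite /tfilt; have lS : (l < (l + j).+1)%N by rewrite ltnS leq_addr.
  by apply: (subvP (sumv_sup (Ordinal lS) _ (subvv _))); rewrite //= addKn mem_tensv.
move: t tF {tA}.
apply: (tfilt_ind (P := fun t => sym3 n (tmap idfun comul t) =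
  tmap idfun _ (gr_tens F n t))) => [|s u IHs IHu|i j a b <- aF bF].
- by rewrite !linear0 sym30.
- by rewrite !linearD /= sym3D IHs IHu.
rewrite gr_tens_tens // !tmap_tens /= gr_comul_symbol //.
by rewrite sym3_tens ?comul_tfilt.
Qed.

HB.instance Definition _ := Falgebra_isHopf.Build K (gr F)
  gr_comulA gr_counitl gr_counitr gr_comul1 gr_comulM gr_counit1 gr_counitM
  gr_antipodel gr_antipoder.

End GrHopfAxioms.

(* Main.v *)
Require Import Defs.
From HB Require Import structures.
From mathcomp Require Import all_boot all_algebra all_field.

(* The trace of a filtered endomorphism equals that of the induced map on the *)
(* associated graded space. With q_i any projection of V onto F_i (q_(-1) = 0)*)
(* and r_i = 1 - q_(i-1), the maps u_i = sym_i q_i : V -> gr F and            *)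
(* w_i : gr F -> V, where w_i is r_i on the class of degree i and 0 on the    *)
(* other classes, satisfy \sum_i u_i w_i = 1. Hence, by cyclicity,            *)
(* tr (gr f) = \sum_i tr (w_i (gr f) u_i) = \sum_i tr (r_i f q_i)             *)
(*           = \sum_i (tr (f q_i) - tr (f q_(i-1))) = tr f,                   *)
(* because q_i q_(i-1) = q_(i-1). It remains to see that the convolution      *)
(* powers and the antipode of gr H are induced by those of H.                 *)

Import GRing.Theory passmx.
Local Open Scope ring_scope.

Lemma linfunE (K : fieldType) (U W : vectType K) (f : U -> W) :
  linear f -> linfun f =1 f.
Proof.
move=> fl; pose fM := GRing.isLinear.Build _ _ _ _ f fl.
pose g : {linear U -> W} := HB.pack f fM.
by move=> u; rewrite (lfunE g).
Qed.

Section Trace.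
Context {K : fieldType}.
Implicit Types U V : vectType K.

Lemma lftraceB V (f g : 'End(V)) : lftrace (f - g) = lftrace f - lftrace g.
Proof. by rewrite /lftrace !linearB. Qed.

Lemma lftrace_sum V I (r : seq I) (f : I -> 'End(V)) :
  lftrace (\sum_(i <- r) f i) = \sum_(i <- r) lftrace (f i).
Proof. by rewrite /lftrace !linear_sum. Qed.

(** The two spaces may differ: cyclicity has to pass between [V] and [gr F]. *)
Lemma lftrace_comp U V (f : 'Hom(U, V)) (g : 'Hom(V, U)) :
  lftrace (f \o g) = lftrace (g \o f).
Proof.
have [bU bV] := (vbasisP {:U}, vbasisP {:V}).
by rewrite /lftrace (mxof_comp _ _ bU) (mxof_comp _ _ bV) mxtrace_mulC.
Qed.

End Trace.

Section GradedMap.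
Context {K : fieldType} {V : vectType K} (F : filtration V).
Local Notation sym := (symbol F).

(* f is filtered and f' is the map gr f that it induces. *)
Definition gr_map (f : 'End(V)) (f' : 'End(gr F)) :=
  forall n v, v \in F n -> f v \in F n /\ f' (sym n v) = sym n (f v).

Let r (i : nat) : 'End(V) := \1%VF - projv (filt_prev F i).

Let rE i v : r i v = v - projv (filt_prev F i) v.
Proof. by rewrite add_lfunE opp_lfunE id_lfunE. Qed.

Let rF i v : v \in F i -> r i v \in F i.
Proof.
move=> vF; rewrite rE memvB //.
by rewrite (subvP (filt_prevS F i)) ?memv_proj.
Qed.

(** Indexed by the degree [j], as [gr_lift] expects; it descends to classes because [r i] kills
    [filt_prev F i]. *)
Let w_fun (i j : nat) (v : V) : V := if j == i then r i v else 0.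

Let w_fun_lin i j : linear (w_fun i j).
Proof.
by move=> a x y; rewrite /w_fun; case: eqP; rewrite ?linearP // scaler0 addr0.
Qed.

Let w_fun_prev i j v : v \in filt_prev F j -> w_fun i j v = 0.
Proof.
by rewrite /w_fun; case: eqP => // -> vF; rewrite rE projv_id ?subrr.
Qed.

Let w (i : nat) : 'Hom(gr F, V) := linfun (gr_lift (w_fun i)).

Let w_symbol i j v : v \in F j -> w i (sym j v) = if j == i then r i v else 0.
Proof.
move=> vF; rewrite linfunE.
  exact: (gr_lift_symbol (w_fun_lin i) (@w_fun_prev i)).
exact: (gr_lift_is_linear (w_fun_lin i) (@w_fun_prev i)).
Qed.

Let u (i : nat) : 'Hom(V, gr F) := (linfun (sym i) \o projv (F i))%VF.

Let uE i v : v \in F i -> u i v = sym i v.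
Proof. by move=> vF; rewrite comp_lfunE projv_id // lfunE. Qed.

(** On a class of degree n only the term i = n survives, and [r n v] differs from [v] by an element
    of F_(n-1), whose symbol in degree n is 0. *)
Let sum_uw x : \sum_(i < (filt_top F).+1) u i (w i x) = x.
Proof.
elim/gr_ind: x => [|x y IHx IHy|n v vF].
- by rewrite big1 // => i _; rewrite !linear0.
- by rewrite -{2}IHx -{2}IHy -big_split; apply: eq_bigr => i _; rewrite !linearD.
have [nN|Nn] := ltnP n (filt_top F).+1; last first.
  by rewrite symbol_prev ?filt_prev_top // big1 // => i _; rewrite !linear0.
rewrite (bigD1 (Ordinal nN)) //= big1 ?addr0 => [|i ni]; last first.
  by rewrite w_symbol // ifN ?linear0 // eq_sym.
rewrite w_symbol // eqxx uE ?rF // rE linearB /= [X in _ - X]symbol_prev ?subr0 //.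
exact: memv_proj.
Qed.

Lemma lftrace_gr (f : 'End(V)) (f' : 'End(gr F)) :
  gr_map f f' -> lftrace f = lftrace f'.
Proof.
move=> ff'; pose t i := lftrace (f \o projv (filt_prev F i)).
transitivity (\sum_(i < (filt_top F).+1) (t i.+1 - t i)).
  (* Since [filt_prev F i.+1] is [F i], the sum telescopes to tr (f q_N) - tr (f q_(-1)) with N =
     [filt_top F], where q_N = 1 and q_(-1) = 0. *)
  rewrite -(big_mkord xpredT (fun i => t i.+1 - t i)) telescope_sumr //.
  rewrite /t /= filt_topE //.
  have -> : (f \o projv fullv = f)%VF.
    by apply/lfunP=> v; rewrite comp_lfunE projv_id ?memvf.
  have -> : (f \o projv 0 = 0)%VF.
    apply/lfunP=> v; rewrite comp_lfunE zero_lfunE.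
    by have := memv_proj 0 v; rewrite memv0 => /eqP->; rewrite linear0.
  by rewrite -[in RHS](subrr 0) lftraceB subrr subr0.
have -> : f' = \sum_(i < (filt_top F).+1) (f' \o u i \o w i)%VF.
  apply/lfunP=> x; rewrite -{1}(sum_uw x) sum_lfunE linear_sum.
  by apply: eq_bigr => i _; rewrite !comp_lfunE.
rewrite lftrace_sum; apply: eq_bigr => i _.
rewrite [RHS]lftrace_comp.
have -> : (w i \o (f' \o u i) = r i \o (f \o projv (F i)))%VF.
  apply/lfunP => v; rewrite !comp_lfunE lfunE /=.
  have [fF ->] := ff' _ _ (memv_proj (F i) v).
  by rewrite w_symbol // eqxx.
(* Cyclicity moves [r i] to the right of q_i, so that the product to simplify is q_i q_(i-1), which
   is q_(i-1) because F_(i-1) lies in F_i. *)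
rewrite [RHS]lftrace_comp /t /= -lftraceB; congr (lftrace _).
apply/lfunP=> v; rewrite add_lfunE opp_lfunE !comp_lfunE rE !linearB /=.
congr (_ - f _); rewrite [RHS]projv_id //.
by rewrite (subvP (filt_prevS F i)) ?memv_proj.
Qed.

End GradedMap.

Section Indicator.
Context {K : fieldType} {H : hopfAlgType K}.

Lemma convE (f g : 'End(H)) h :
  conv f g h = tlift (fun a b => f a * g b) (comul h).
Proof. by rewrite linfunE // => a x y; rewrite !linearP. Qed.

Lemma conv1E (h : H) : conv1 H h = (counit h : K) *: 1.
Proof. by rewrite linfunE // => a x y; rewrite linearP scalerDl -scalerA. Qed.

End Indicator.

Section GrIndicator.
Context {K : fieldType} {H : hopfAlgType K} (F : hopfFiltration H).
Local Notation sym := (symbol F).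

Lemma gr_map_id : gr_map F \1 \1.
Proof. by move=> n v vF; rewrite !id_lfunE. Qed.

Lemma gr_map_comp f f' g g' :
  gr_map F f f' -> gr_map F g g' -> gr_map F (f \o g) (f' \o g').
Proof.
move=> ff' gg' n v vF; have [gvF gE] := gg' n v vF.
by have [fgvF fE] := ff' n _ gvF; rewrite !comp_lfunE gE.
Qed.

Lemma gr_map_antipode : gr_map F antipode antipode.
Proof.
by move=> n v vF; rewrite antipode_filt //; split=> //; apply: gr_antipode_symbol.
Qed.

(** In degree n > 0 both sides vanish: the graded counit is 0 there, and scalars lie in F_0. *)
Lemma gr_map_conv1 : gr_map F (conv1 H) (conv1 (gr F)).
Proof.
move=> n v vF; rewrite !conv1E memvZ ?one_filt //; split=> //.
exact: gr_counit_scale1.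
Qed.

(** The coproduct of an element of F_n is a sum of tensors in F_i and F_j with i + j = n, and on
    these symbols are multiplicative. *)
Lemma gr_map_conv f f' g g' :
  gr_map F f f' -> gr_map F g g' -> gr_map F (conv f g) (conv f' g').
Proof.
move=> ff' gg' n v vF; rewrite !convE; split.
  apply: (tfilt_ind (P := fun t => tlift _ t \in F n)) (comul_tfilt vF).
  - by rewrite linear0 mem0v.
  - by move=> s t sF tF; rewrite linearD memvD.
  move=> i j a b <- aF bF; rewrite tlift_tens; last exact: bilin_mul.
  by rewrite mul_filt ?(ff' _ _ aF).1 ?(gg' _ _ bF).1.
rewrite [comul (sym n v)](gr_comul_symbol vF).
apply: tlift_gr_tens (comul_tfilt vF); try exact: bilin_mul.
move=> i j a b aF bF; have [[faF ->] [gbF ->]] := (ff' _ _ aF, gg' _ _ bF).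
exact: symbolM.
Qed.

Lemma gr_map_convpow m : gr_map F (convpow H m) (convpow (gr F) m).
Proof.
elim: m => [|m IHm]; first exact: gr_map_conv1.
exact: gr_map_conv gr_map_id IHm.
Qed.

End GrIndicator.

Theorem theorem3p9 (k : fieldType) (H : hopfAlgType k) (F : hopfFiltration H)
    (n : nat) (hn : (1 <= n)%N) :
  nu H n = nu (gr F) n.
Proof.
apply: (lftrace_gr F); apply: gr_map_comp; first exact: gr_map_antipode.
exact: gr_map_convpow.
Qed.
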